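(* Let $G$ be a simple graph on $n$ vertices with maximum degree $\Delta(G)$, and let $k$ be an integer with $2\le k\le n-1$. If $\alpha(F_k(G))$ is not a Laplacian eigenvalue of $F_{k-1}(G)$, then $$\alpha(F_k(G))\ge\begin{cases}\dfrac{k}{k-1}\,\alpha(F_{k-1}(G))-\dfrac{k}{k-2}\min\{k-2,\Delta(G)\} & \text{if } k>2,\\[2mm] 2\alpha(G)-2 & \text{if } k=2.\end{cases}$$
   Context: For a simple graph $G$ with vertex set $[n]=\{1,\dots,n\}$ and $1\le k\le n$, the $k$-token graph $F_k(G)$ is the graph whose vertices are the $k$-subsets of $[n]$, two $k$-subsets $A,B$ being adjacent whenever $A\triangle B=\{a,b\}$ with $a\in A$, $b\in B$ and $\{a,b\}\in E(G)$; $F_1(G)\cong G$. Laplacian eigenvalues are eigenvalues of $L=D-A$, and the algebraic connectivity $\alpha(H)$ of a graph $H$ is its second smallest Laplacian eigenvalue. *)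

(* Defs.v *)
From HB Require Import structures.
From mathcomp Require Import all_boot all_order all_algebra.
From mathcomp Require Import polyrcf.

Set Implicit Arguments.
Unset Strict Implicit.
Unset Printing Implicit Defensive.

Import Order.TTheory GRing.Theory Num.Theory.

Local Open Scope ring_scope.

Record sgraph (V : finType) := SGraph {
  edge :> rel V;
  edge_sym : symmetric edge;
  edge_irr : irreflexive edge }.

Definition degree (V : finType) (G : sgraph V) (x : V) : nat :=
  #|[set y | edge G x y]|.

Definition max_degree (V : finType) (G : sgraph V) : nat :=
  (\max_(x : V) degree G x)%N.

Notation ksubset V k := {A : {set V} | #|A| == k}.

Definition token_adj (V : finType) (G : sgraph V) (k : nat)
    (A B : ksubset V k) : bool :=
  [exists a : V, exists b : V,
     [&& a \in val A, b \in val B, edge G a b &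
         (val A :\: val B) :|: (val B :\: val A) == [set a; b]]].

Lemma token_adj_sym (V : finType) (G : sgraph V) (k : nat) :
  symmetric (@token_adj V G k).
Proof.
suff sub A B : @token_adj V G k A B -> token_adj G B A.
  by move=> A B; apply/idP/idP; apply: sub.
case/existsP=> a /existsP [b /and4P [aA bB eab /eqP sAB]].
apply/existsP; exists b; apply/existsP; exists a.
by rewrite bB aA edge_sym eab setUC sAB setUC eqxx.
Qed.

Lemma token_adj_irr (V : finType) (G : sgraph V) (k : nat) :
  irreflexive (@token_adj V G k).
Proof.
move=> A; apply: negbTE; apply/negP=> /existsP [a /existsP [b /and4P [_ _ _ /eqP]]].
by move/setP/(_ a); rewrite setDv setUid !inE eqxx.
Qed.

Definition token_graph (V : finType) (k : nat) (G : sgraph V) :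
    sgraph (ksubset V k) :=
  SGraph (@token_adj_sym V G k) (@token_adj_irr V G k).

Definition degree_mx (R : rcfType) (V : finType) (G : sgraph V) : 'M[R]_#|V| :=
  diag_mx (\row_i (degree G (enum_val i))%:R).

Definition adjacency_mx (R : rcfType) (V : finType) (G : sgraph V) :
    'M[R]_#|V| :=
  \matrix_(i, j) (edge G (enum_val i) (enum_val j))%:R.

Definition laplacian (R : rcfType) (V : finType) (G : sgraph V) :
    'M[R]_#|V| :=
  degree_mx R G - adjacency_mx R G.

(* The eigenvalues of M lying in R, repeated according to their algebraic
   multiplicity and in nondecreasing order; for a symmetric M this is the
   whole spectrum, of size n. *)
Definition spectrum (R : rcfType) (n : nat) (M : 'M[R]_n) : seq R :=
  sort <=%R (flatten
    [seq nseq (mup x (char_poly M)) x | x <- rootsR (char_poly M)]).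

(* The second smallest Laplacian eigenvalue counted with multiplicity (0 when G
   is disconnected).  The default 0 is only reached when #|V| < 2. *)
Definition alg_connectivity (R : rcfType) (V : finType) (G : sgraph V) : R :=
  nth 0 (spectrum (laplacian R G)) 1.

(* Main.v *)
(* Let F be an eigenvector of L(F_k) for mu = alpha(F_k).  Summing over supersets
   intertwines the Laplacians of F_k and F_(k-1), so as mu is not an eigenvalue
   of F_(k-1), F sums to 0 over the k-sets containing any given (k-1)-set.  Hence
   each slice F_i : S |-> [i notin S] F(S + i), a function on (k-1)-sets, is
   orthogonal to the constants, and the Poincare inequality of F_(k-1) applies to
   it.  Summing over i, the norms add up to k |F|^2 and the energies to
   (k-1) mu |F|^2 plus the boundary terms sum_A 2 e(G[A]) F(A)^2, where
   2 e(G[A]) <= k min(k-1, Delta).  This gives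
     k alpha(F_(k-1)) <= (k-1) mu + k min(k-1, Delta),
   which implies both cases.  An eigenvector is available because 0 is an
   eigenvalue of F_(k-1), so that mu <> 0 is not the default value. *)

Require Import Defs.
From mathcomp Require Import all_boot all_order all_algebra.
From mathcomp Require Import polyrcf complex spectral sesquilinear.
From mathcomp Require Import ring lra.

Set Implicit Arguments.
Unset Strict Implicit.
Unset Printing Implicit Defensive.

Import Order.TTheory GRing.Theory Num.Theory.
Local Open Scope ring_scope.

(** * Spectral decomposition of real symmetric matrices *)

Section SymmetricSpectrum.
Local Open Scope sesquilinear_scope.
Variables (R : rcfType) (n : nat) (A : 'M[R]_n).
Hypothesis symA : A^T = A.

(** Over [R[i]] the matrix is hermitian, so the complex spectral theorem diagonalizes it with real
    eigenvalues. The factorization of [char_poly A] descends to [R] because [map_poly] along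
    [real_complex] is injective. *)
Lemma symmetric_spectral :
  exists (r : 'I_n -> R) (P : 'M[R[i]]_n),
  [/\ P \is unitarymx,
      map_mx (real_complex R) A =
        P^t* *m diag_mx (\row_j real_complex R (r j)) *m P
    & char_poly A = \prod_j ('X - (r j)%:P)].
Proof.
set B := map_mx (real_complex R) A.
have BH : B \is hermsymmx.
  apply: realsym_hermsym.
    apply/is_hermitianmxP; rewrite expr0 scale1r; apply/matrixP=> i j.
    by rewrite !mxE -{1}symA mxE.
  by apply/mxOverP=> i j; rewrite mxE; apply/complex_realP; exists (A i j).
have /orthomx_spectralP eqB := hermitian_normalmx BH.
have realD := hermitian_spectral_diag_real BH.
pose D := spectral_diag B; pose P := spectralmx B.
have P_unit : P \is unitarymx := spectral_unitarymx B.
pose r j := complex.Re (D 0 j).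
have eqD : \row_j real_complex R (r j) = D.
  by apply/rowP=> j; rewrite mxE RRe_real //; apply: (mxOverP realD).
exists r, P; split=> //; first by rewrite eqD -invmx_unitary.
apply: (map_poly_inj (real_complex R)); rewrite map_char_poly -/B.
have -> : char_poly B = char_poly (diag_mx D).
  rewrite /char_poly.
  have cf : map_mx polyC (invmx P) *m map_mx polyC P = 1%:M.
    by rewrite -map_mxM mulVmx ?map_mx1 // spectral_unit.
  have -> : char_poly_mx B =
    map_mx polyC (invmx P) *m char_poly_mx (diag_mx D) *m map_mx polyC P.
    rewrite /char_poly_mx mulmxBr mulmxBl scalar_mxC -[_%:M *m _ *m _]mulmxA cf mulmx1.
    by rewrite -!map_mxM -eqB.
  by rewrite !det_mulmx mulrAC -det_mulmx cf det1 mul1r.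
rewrite char_poly_trig ?diag_mx_is_trig // rmorph_prod; apply: eq_bigr => j _.
by rewrite rmorphB /= map_polyX map_polyC /= -eqD !mxE eqxx.
Qed.

(** Both lists contain each [x] as often as its multiplicity as a root of [char_poly A]. *)
Lemma spectrum_perm (r : 'I_n -> R) :
  char_poly A = \prod_j ('X - (r j)%:P) ->
  perm_eq (spectrum A) (codom r).
Proof.
move=> chiA; rewrite perm_sort; apply/allP => x _ /=; apply/eqP.
have chi0 : char_poly A != 0 by rewrite monic_neq0 ?char_poly_monic.
have -> : count_mem x (codom r) = mup x (char_poly A).
  by rewrite chiA -mu_prod_XsubC /codom /image_mem big_map big_enum.
have rootsE y : (y \in rootsR (char_poly A)) = root (char_poly A) y.
  by have /(_ y) := roots_on_rootsR chi0; rewrite inE.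
have uR : uniq (rootsR (char_poly A)) by rewrite /rootsR uniq_roots.
have [xR|xNR] := boolP (root (char_poly A) x); last first.
  rewrite mupNroot //; apply/count_memPn/flattenP => -[s /mapP[y yR ->]].
  by rewrite mem_nseq => /andP[_ /eqP xy]; rewrite xy -rootsE yR in xNR.
rewrite count_flatten -map_comp sumnE big_map.
rewrite (bigD1_seq x) ?rootsE //= count_nseq /= eqxx mul1n.
rewrite big1 ?addn0 // => y /negPf yx.
by rewrite count_nseq /= yx mul0n.
Qed.

Lemma spectrum_root x : x \in spectrum A -> eigenvalue A x.
Proof.
rewrite mem_sort => /flattenP[s /mapP[y yR ->]]; rewrite mem_nseq.
case/andP => _ /eqP ->; rewrite eigenvalue_root_char.
have chi0 : char_poly A != 0 by rewrite monic_neq0 ?char_poly_monic.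
by have /(_ y) := roots_on_rootsR chi0; rewrite yR inE /= => ->.
Qed.

(* If the second eigenvalue is positive, all but one coordinate of [u] in a
   unitary eigenbasis vanish, so [g] has no component along the exception. *)
Lemma second_eigenvalue_le (u g : 'rV[R]_n) :
  (forall h : 'rV[R]_n, 0 <= (h *m A *m h^T) 0 0) ->
  u != 0 -> u *m A = 0 -> g *m u^T = 0 ->
  (spectrum A)`_1 * (g *m g^T) 0 0 <= (g *m A *m g^T) 0 0.
Proof.
move=> psdA u0 uA gu.
(* A spectrum with fewer than two entries falls into the first case, through the default 0 of
   [nth]. *)
set l := _`_1; have [l_le0|l_gt0] := lerP l 0.
  apply: le_trans (psdA g); rewrite mulr_le0_ge0 // mxE sumr_ge0 // => i _.
  by rewrite mxE -expr2 sqr_ge0.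
have [r [P [P_unit eqA chiA]]] := symmetric_spectral.
have perm_r := spectrum_perm chiA.
(* The spectrum is sorted and [l] is its second entry, so only its first entry can lie below [l]. *)
have one_small i j : r i < l -> r j < l -> i = j.
  move=> ri rj; apply/eqP; apply: contraLR l_gt0 => ij.
  have s_gt1 : (1 < count (fun x => (x < l)%R) (spectrum A))%N.
    rewrite (permP perm_r) /codom /image_mem count_map -size_filter.
    rewrite (@uniq_leq_size _ [:: i; j]) //= ?inE ?ij // => k.
    by rewrite mem_filter mem_enum !inE => /orP[] /eqP->; rewrite ?ri ?rj.
  have srt : sorted <=%R (spectrum A) by apply: sort_sorted; apply: le_total.
  move: s_gt1 srt; rewrite /l; case: (spectrum A) => [|a [|b s]] //=.
    by rewrite addn0; case: (_ < _).
  rewrite ltxx add0n => cnt /andP[_ bs].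
  suff c0 : count (fun x => (x < b)%R) s = 0%N.
    by move: cnt; rewrite c0; case: (_ < _).
  apply/eqP; rewrite -leqn0 leqNgt -has_count; apply/hasPn => x xs.
  by rewrite -leNgt; have /allP/(_ x xs) := order_path_min le_trans bs.
pose toC := map_mx (real_complex R) : 'rV[R]_n -> 'rV[R[i]]_n.
pose c h := toC h *m P^t*.
have PP : P^t* *m P = 1%:M by rewrite -invmx_unitary // mulVmx ?unitarymx_unit.
have cE h : toC h = c h *m P by rewrite -mulmxA PP mulmx1.
have realJ (h : 'rV[R]_n) : (toC h)^t* = (map_mx (real_complex R) h^T).
  by apply/matrixP=> i j; rewrite !mxE -[RHS]conjc_real.
have ctE h : (map_mx (real_complex R) h^T) = P^t* *m (c h)^t*.
  by rewrite -realJ cE trmx_mul map_mxM.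
have dotE h h' : real_complex R ((h *m h'^T) 0 0) =
    \sum_j c h 0 j * (c h' 0 j)^*.
  transitivity ((toC h *m map_mx (real_complex R) h'^T) 0 0).
    by rewrite -map_mxM [RHS]mxE.
  by rewrite ctE mulmxA mxE; apply: eq_bigr => j _; rewrite !mxE.
have formE h : real_complex R ((h *m A *m h^T) 0 0) =
    \sum_j real_complex R (r j) * (c h 0 j * (c h 0 j)^*).
  transitivity ((toC h *m map_mx (real_complex R) A *m map_mx (real_complex R) h^T) 0 0).
    by rewrite -!map_mxM [RHS]mxE.
  rewrite eqA ctE !mulmxA -/(c h) -(mulmxA _ P) (unitarymxP P_unit) mulmx1.
  rewrite mxE; apply: eq_bigr => j _.
  by rewrite mul_mx_diag !mxE mulrCA mulrA.
(* In the eigenbasis, [u *m A = 0] says that [u] is supported where the eigenvalue is 0; since 0 <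
   [l], this is a single index [i]. *)
have cuA j : real_complex R (r j) * c u 0 j = 0.
  have : toC u *m map_mx (real_complex R) A = 0 by rewrite -map_mxM uA map_mx0.
  move/(congr1 (fun X => (X *m P^t*) 0 j)).
  rewrite eqA !mulmxA -/(c u) -[_ *m P *m _]mulmxA (unitarymxP P_unit) mulmx1 mul0mx.
  by rewrite mul_mx_diag !mxE mulrC.
have [i ui] : exists i, c u 0 i != 0.
  apply/existsP; apply: contraNT u0; rewrite negb_exists => /forallP uz.
  have c0 : c u = 0.
    by apply/rowP=> j; rewrite [RHS]mxE; apply/eqP; have := uz j; rewrite negbK.
  apply/eqP; apply: (@map_mx_inj _ _ (real_complex R)).
  by rewrite [LHS]cE c0 mul0mx map_mx0.
have ri : r i = 0.
  by have /eqP := cuA i; rewrite mulf_eq0 (negPf ui) orbF => /eqP [].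
have large j : j != i -> l <= r j.
  move=> ji; rewrite leNgt; apply: contra ji => rj.
  by apply/eqP/one_small; rewrite ?ri.
have uj j : j != i -> c u 0 j = 0.
  move=> /large /(lt_le_trans l_gt0) rj; have /eqP := cuA j.
  rewrite mulf_eq0 => /orP[/eqP [rj0]|/eqP //].
  by rewrite rj0 ltxx in rj.
(* As [u] is supported on [i] alone, its product with [g] reduces to one term. *)
have gi : c g 0 i = 0.
  have /esym/eqP := dotE g u; rewrite gu mxE.
  rewrite (bigD1 i) //= big1 => [|j /uj ->]; last by rewrite conjC0 mulr0.
  by rewrite addr0 mulf_eq0 conjC_eq0 (negPf ui) orbF => /eqP.
rewrite -lecR formE rmorphM /= dotE mulr_sumr; apply: ler_sum => j _.
have [->|ji] := eqVneq j i; first by rewrite gi mul0r !mulr0.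
by rewrite ler_wpM2r ?mul_conjC_ge0 // lecR large.
Qed.

End SymmetricSpectrum.

(** * Dirichlet form and Poincare inequality of a graph *)

Section GraphLaplacian.
Variables (R : rcfType) (V : finType) (H : sgraph V).
Implicit Types f : V -> R.

Definition graph_laplacian f x := \sum_(y | edge H x y) (f x - f y).

(* Each edge is counted in both directions, hence the factors 2 below. *)
Definition dirichlet f := \sum_x \sum_(y | edge H x y) (f x - f y) ^+ 2.

Definition vertex_row f : 'rV[R]_#|V| := \row_i f (enum_val i).

Lemma vertex_row_surj (v : 'rV[R]_#|V|) :
  v = vertex_row (fun x => v 0 (enum_rank x)).
Proof. by apply/rowP=> i; rewrite mxE enum_valK. Qed.

Lemma vertex_row_dot f g : (vertex_row f *m (vertex_row g)^T) 0 0 = \sum_x f x * g x.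
Proof. by rewrite mxE [RHS]big_enum_val; apply: eq_bigr => i _; rewrite !mxE. Qed.

Lemma vertex_row_eq0 f : (forall x, f x = 0) <-> vertex_row f = 0.
Proof.
split=> [f0|/rowP f0 x]; first by apply/rowP=> i; rewrite !mxE f0.
by have := f0 (enum_rank x); rewrite !mxE enum_rankK.
Qed.

Lemma laplacian_sym : (laplacian R H)^T = laplacian R H.
Proof.
rewrite /laplacian linearB /= tr_diag_mx; congr (_ - _).
by apply/matrixP=> i j; rewrite !mxE edge_sym.
Qed.

Lemma vertex_row_laplacian f :
  vertex_row f *m laplacian R H = vertex_row (graph_laplacian f).
Proof.
apply/rowP=> j; rewrite /laplacian mulmxBr mul_mx_diag !mxE.
rewrite /graph_laplacian sumrB sumr_const mulr_natr; congr (_ *+ _ - _).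
  by rewrite /degree cardsE.
rewrite [RHS]big_mkcond [RHS]big_enum_val; apply: eq_bigr => i _.
by rewrite !mxE edge_sym; case: (edge H _ _); rewrite ?mulr1 ?mulr0.
Qed.

(** Add the sum on the right to its copy with the ends of each edge swapped: f x (f x - f y) + f y
    (f y - f x) = (f x - f y)^2. *)
Lemma dirichletE f : dirichlet f = 2 * \sum_x f x * graph_laplacian f x.
Proof.
have sumD : \sum_x f x * graph_laplacian f x =
    \sum_x \sum_(y | edge H x y) f x * (f x - f y).
  by apply: eq_bigr => x _; rewrite mulr_sumr.
have sumD' : \sum_x f x * graph_laplacian f x =
    \sum_x \sum_(y | edge H x y) f y * (f y - f x).
  rewrite sumD (exchange_big_dep xpredT) //=; apply: eq_bigr => x _.
  by apply: eq_bigl => y; rewrite edge_sym.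
rewrite mulr_natl mulr2n {1}sumD sumD' -big_split; apply: eq_bigr => x _.
rewrite -big_split; apply: eq_bigr => y _ /=; ring.
Qed.

Lemma dirichlet_ge0 f : 0 <= dirichlet f.
Proof. by apply: sumr_ge0 => x _; apply: sumr_ge0 => y _; apply: sqr_ge0. Qed.

(** The constant 1 is in the kernel of the Laplacian, and serves as the vector [u] of
    [second_eigenvalue_le]. *)
Lemma poincare f : \sum_x f x = 0 ->
  2 * alg_connectivity R H * \sum_x f x ^+ 2 <= dirichlet f.
Proof.
move=> sum_f.
have formE h : (vertex_row h *m laplacian R H *m (vertex_row h)^T) 0 0 =
    \sum_x h x * graph_laplacian h x.
  rewrite vertex_row_laplacian vertex_row_dot.
  by apply: eq_bigr => x _; rewrite mulrC.
rewrite dirichletE -mulrA ler_pM2l ?ltr0n // -formE.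
have -> : \sum_x f x ^+ 2 = (vertex_row f *m (vertex_row f)^T) 0 0.
  by rewrite vertex_row_dot; apply: eq_bigr => x _; rewrite expr2.
have [V0|/card_gt0P[x0 _]] := posnP #|V|.
  have v0 : vertex_row f = 0.
    by apply/vertex_row_eq0 => x; have := card0_eq V0 x; rewrite inE.
  by rewrite v0 !mul0mx mxE mulr0.
apply: (@second_eigenvalue_le _ _ _ laplacian_sym (vertex_row (fun=> 1))).
- move=> h; rewrite (vertex_row_surj h) formE.
  by rewrite -(pmulr_rge0 _ (ltr0n R 2)) -dirichletE dirichlet_ge0.
- by apply/eqP => /vertex_row_eq0/(_ x0)/eqP; rewrite oner_eq0.
- rewrite vertex_row_laplacian; apply/vertex_row_eq0 => x.
  by apply: big1 => y _; rewrite subrr.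
- apply/matrixP=> i j; rewrite !ord1 vertex_row_dot mxE -[RHS]sum_f.
  by apply: eq_bigr => x _; rewrite mulr1.
Qed.

Lemma laplacian_eigenvalueP (mu : R) :
  reflect (exists2 f, forall x, graph_laplacian f x = mu * f x
                    & exists x, f x != 0)
          (eigenvalue (laplacian R H) mu).
Proof.
apply: (iffP eigenvalueP) => [[v vL v0]|[f fL [x fx]]].
  pose f x := v 0 (enum_rank x); have vE : v = vertex_row f := vertex_row_surj v.
  exists f => [x|].
    move: vL; rewrite vE vertex_row_laplacian => /rowP/(_ (enum_rank x)).
    by rewrite !mxE enum_rankK.
  apply/existsP; apply: contraNT v0; rewrite negb_exists => /forallP f0.
  by rewrite vE; apply/eqP/vertex_row_eq0 => x; apply/eqP; have := f0 x; rewrite negbK.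
exists (vertex_row f).
  by rewrite vertex_row_laplacian; apply/rowP=> i; rewrite !mxE fL.
by apply: contraNneq fx => /vertex_row_eq0 ->.
Qed.

(** A nonzero value cannot be the default of [nth], so it is an entry of the spectrum. *)
Lemma alg_connectivity_eigenvalue :
  alg_connectivity R H != 0 -> eigenvalue (laplacian R H) (alg_connectivity R H).
Proof.
move=> a0; apply/spectrum_root/mem_nth; rewrite ltnNge.
by apply: contra a0 => sz; rewrite /alg_connectivity nth_default.
Qed.

End GraphLaplacian.

(** * Token moves, slices and their energies *)

Section TokenSums.
Variables (R : rcfType) (V : finType) (G : sgraph V).
Implicit Types (A S : {set V}) (F : {set V} -> R) (m : nat).

Definition move_token A a b : {set V} := b |: A :\ a.

(** Double counting through the bijection between pairs (S, x) with x outside S and pairs (A, x)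
    with x in A, where A = S + x. *)
Lemma sum_insert m (phi : {set V} -> V -> R) :
  \sum_(S : {set V} | #|S| == m) \sum_(x | x \notin S) phi S x =
  \sum_(A : {set V} | #|A| == m.+1) \sum_(x in A) phi (A :\ x) x.
Proof.
rewrite !pair_big_dep /=.
rewrite (reindex_onto (fun p => (p.1 :\ p.2, p.2)) (fun p => (p.2 |: p.1, p.2)))
  => [|[S x] /= /andP[_ xS]]; last by rewrite setU1K.
apply: eq_bigl => -[A x] /=; rewrite !inE eqxx andbT xpair_eqE eqxx andbT.
have [xA|xA] := boolP (x \in A).
  by rewrite setD1K // eqxx (cardsD1 x A) xA.
rewrite !andbF; apply/negP => /andP[_ /eqP AE].
by rewrite -AE setU11 in xA.
Qed.

(** Neighbours of [X] correspond to moves a -> b along an edge leaving [X]; the two set differences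
    recover a and b, so distinct moves give distinct neighbours. *)
Lemma sum_token_adj k (X : ksubset V k) (phi : {set V} -> R) :
  \sum_(Y : ksubset V k | edge (token_graph k G) X Y) phi (val Y) =
  \sum_(a in val X) \sum_(b | (b \notin val X) && edge G a b)
    phi (move_token (val X) a b).
Proof.
set A := val X; have cA : #|A| == k := valP X.
pose D := [set p : V * V | [&& p.1 \in A, p.2 \notin A & edge G p.1 p.2]].
have diffl p : p \in D -> A :\: move_token A p.1 p.2 = [set p.1].
  case: p => a b; rewrite inE /= => /and3P[aA bA _]; apply/setP=> x.
  rewrite !inE; case: eqVneq => [->|xb].
    by rewrite (negPf bA) andbF; case: eqVneq bA => // ->; rewrite aA.
  by case: eqVneq => [->|] /=; rewrite ?aA //; case: (x \in A).
have diffr p : p \in D -> move_token A p.1 p.2 :\: A = [set p.2].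
  case: p => a b; rewrite inE /= => /and3P[aA bA _]; apply/setP=> x.
  rewrite !inE; case: eqVneq => [->|xb]; first by rewrite bA.
  by case: (x \in A); rewrite ?andbF.
rewrite pair_big_dep /= (eq_bigl (mem D)) => [|p]; last by rewrite !inE.
rewrite -[RHS](@big_imset _ _ _ _ _ (fun p => move_token A p.1 p.2) (mem D) phi) /=;
  last first.
  move=> [a b] [c d] pD qD e.
  have /set1_inj /= -> : [set (a, b).1] = [set (c, d).1].
    by rewrite -diffl // -[RHS]diffl // e.
  have /set1_inj /= -> // : [set (a, b).2] = [set (c, d).2].
  by rewrite -diffr // -[RHS]diffr // e.
rewrite (reindex_omap (val : ksubset V k -> {set V}) insub).
  apply: eq_bigl => Y; rewrite valK eqxx andbT.
  apply/existsP/imsetP => [[a /existsP[b /and4P[aA bY eab /eqP AY]]]|[[a b] pD YE]].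
    have aY : a \notin val Y.
      by move/setP/(_ a): AY; rewrite !inE eqxx aA /=; case: (_ \in val Y).
    have bA : b \notin A.
      by move/setP/(_ b): AY; rewrite !inE eqxx orbT bY /= andbT; case: (_ \in _).
    exists (a, b); first by rewrite inE aA bA.
    apply/setP=> x; rewrite !inE /=; have /setP/(_ x) := AY; rewrite !inE -/A.
    have [->|xb] := eqVneq x b; first by rewrite bY.
    have [->|xa] := eqVneq x a; first by rewrite (negPf aY).
    by rewrite /=; case: (x \in A); case: (x \in val Y).
  exists a; apply/existsP; exists b.
  have := pD; rewrite inE /= => /and3P[aA bA eab].
  by rewrite YE -/A /= (diffl _ pD) (diffr _ pD) aA eab eqxx !inE eqxx.
move=> B /imsetP[[a b] pD ->]; rewrite insubT //=.
have := pD; rewrite inE /= => /and3P[aA bA _].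
by rewrite /move_token cardsU1 !inE (negPf bA) andbF /= add1n -(eqP cA) (cardsD1 a A) aA.
Qed.

(** Functions live on all of [{set V}], so that sets of sizes m and m+1 can be mixed without
    dependent types. *)
Definition token_laplacian F A :=
  \sum_(a in A) \sum_(b | (b \notin A) && edge G a b) (F A - F (move_token A a b)).

Definition token_energy m F :=
  \sum_(A : {set V} | #|A| == m)
    \sum_(a in A) \sum_(b | (b \notin A) && edge G a b)
      (F A - F (move_token A a b)) ^+ 2.

Definition insertion_sum F S := \sum_(x | x \notin S) F (x |: S).

Definition slice F i S := if i \in S then 0 else F (i |: S).

Lemma sum_ksubset k F :
  \sum_(X : ksubset V k) F (val X) = \sum_(A : {set V} | #|A| == k) F A.
Proof.
rewrite [RHS](reindex_omap (val : ksubset V k -> {set V}) insub).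
  by apply: eq_bigl => X; rewrite valK eqxx (valP X).
by move=> A cA; rewrite insubT.
Qed.

Lemma graph_laplacian_token k F (X : ksubset V k) :
  graph_laplacian (token_graph k G) (F \o val) X = token_laplacian F (val X).
Proof. exact: (sum_token_adj X (fun B => F (val X) - F B)). Qed.

Lemma dirichlet_token k F :
  dirichlet (token_graph k G) (F \o val) = token_energy k F.
Proof.
rewrite /token_energy -sum_ksubset; apply: eq_bigr => X _.
exact: (sum_token_adj X (fun B => (F (val X) - F B) ^+ 2)).
Qed.

Lemma setU1_move i S a b : i != a -> i |: move_token S a b = move_token (i |: S) a b.
Proof.
by move=> ia; apply/setP=> x; rewrite !inE; case: (eqVneq x i) => [->|]; rewrite ?ia ?orbT.
Qed.

Lemma setU1_move_id S a b : a \in S -> a |: move_token S a b = b |: S.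
Proof.
by move=> aS; apply/setP=> x; rewrite !inE; case: (eqVneq x a) => [->|]; rewrite ?aS ?orbT.
Qed.

(** Split the moves of S + x into those of the inserted x and those of a token a of S. The former
    cancel over all x; the latter add up to the moves of S. *)
Lemma insertion_sum_laplacian F S :
  insertion_sum (token_laplacian F) S = token_laplacian (insertion_sum F) S.
Proof.
have step x : x \notin S -> token_laplacian F (x |: S) =
    \sum_(b | (b \notin S) && edge G x b) (F (x |: S) - F (b |: S)) +
    \sum_(a in S) \sum_(b | [&& b \notin S, b != x & edge G a b])
      (F (x |: S) - F (x |: move_token S a b)).
  move=> xS; rewrite /token_laplacian big_setU1 //=; congr (_ + _).
    apply: eq_big => [b|b _]; last by rewrite /move_token setU1K.
    by rewrite !inE negb_or; case: eqVneq => //= ->; rewrite edge_irr andbF.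
  apply: eq_bigr => a aS; apply: eq_big => [b|b _].
    by rewrite !inE negb_or andbCA andbA.
  by rewrite setU1_move //; apply: contraNneq xS => ->.
rewrite /insertion_sum (eq_bigr _ step) big_split /=.
(* The summand is antisymmetric in x and b, which range over the adjacent pairs outside S. *)
rewrite [X in X + _](_ : _ = 0) ?add0r; last first.
  under eq_bigr do rewrite sumrB.
  rewrite sumrB; apply/eqP; rewrite subr_eq0; apply/eqP.
  rewrite [RHS](exchange_big_dep (fun b => b \notin S)) /=; last by move=> x b _ /andP[].
  apply: eq_bigr => x xS; apply: eq_bigl => b.
  by rewrite edge_sym xS.
rewrite (exchange_big_dep (mem S)) //=; apply: eq_bigr => a aS.
rewrite (exchange_big_dep (fun b => (b \notin S) && edge G a b)) /=; last first.
  by move=> x b _ /and3P[-> _ ->].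
apply: eq_bigr => b /andP[bS eab].
(* The right side has two extra insertions, b into S and a into the moved set; both yield S + b and
   cancel. *)
rewrite [X in _ = X - _](bigD1 b) //= [X in _ = _ - X](bigD1 a) /=; last first.
  by rewrite !inE eqxx /= orbF; apply: contraNneq bS => <-.
rewrite setU1_move_id // opprD addrACA subrr add0r sumrB; congr (_ - _).
  by apply: eq_bigl => x; rewrite aS bS eab !andbT eq_sym.
apply: eq_bigl => x; rewrite aS bS eab !andbT /= !inE.
case: (eqVneq x a) => [->|_]; first by rewrite aS andbF.
by rewrite /= negb_or andbC andbT eq_sym.
Qed.

Lemma sum_slice m F i :
  \sum_(S : {set V} | #|S| == m) slice F i S =
  \sum_(A : {set V} | (#|A| == m.+1) && (i \in A)) F A.
Proof.
transitivity (\sum_(S : {set V} | #|S| == m) \sum_(x | x \notin S)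
    if x == i then F (x |: S) else 0).
  apply: eq_bigr => S _; rewrite -big_mkcondr /slice.
  have [iS|iS] := boolP (i \in S).
    by rewrite big1 // => x /andP[xS /eqP xi]; rewrite xi iS in xS.
  rewrite (bigD1 i) ?iS ?eqxx //= big1 ?addr0 // => x.
  by case/andP => /andP[_ ->].
rewrite sum_insert big_mkcondr; apply: eq_bigr => A _.
rewrite -big_mkcondr; case: ifP => iA; last first.
  by rewrite big1 // => x /andP[xA /eqP xi]; rewrite -xi xA in iA.
rewrite (bigD1 i) ?iA ?eqxx //= setD1K // big1 ?addr0 // => x.
by case/andP => /andP[_ ->].
Qed.

(** Sum [insertion_sum F S] over the m-sets S containing i. Each (m+1)-set A containing i arises m
    times, once for each element other than i that can be removed. *)
Lemma sum_slice_eq0 m F i : (0 < m)%N ->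
  (forall S : {set V}, #|S| = m -> insertion_sum F S = 0) ->
  \sum_(S : {set V} | #|S| == m) slice F i S = 0.
Proof.
move=> m0 F0; rewrite sum_slice.
apply/eqP; suff : (\sum_(A : {set V} | (#|A| == m.+1) && (i \in A)) F A) *+ m == 0.
  by rewrite mulrn_eq0 eqn0Ngt m0.
apply/eqP; rewrite -sumrMnl.
transitivity (\sum_(S : {set V} | #|S| == m) \sum_(x | x \notin S)
    if i \in S then F (x |: S) else 0); last first.
  apply: big1 => S /eqP cS; case: (i \in S); first exact: F0.
  exact: big1.
rewrite sum_insert big_mkcondr; apply: eq_bigr => A /eqP cA.
rewrite -big_mkcondr /=; case: ifP => iA; last first.
  by rewrite big1 // => x; rewrite !inE iA !andbF.
rewrite (eq_bigr (fun=> F A)) => [|x /andP[xA _]]; last by rewrite setD1K.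
rewrite sumr_const; congr (_ *+ _).
have := cardsD1 i A; rewrite iA cA => -[->]; apply: eq_card => x.
by rewrite -[RHS]/((x \in A) && (i \in A :\ x)) !inE iA andbT andbC eq_sym.
Qed.

Lemma sum_slice_sqr m F :
  \sum_i \sum_(S : {set V} | #|S| == m) slice F i S ^+ 2 =
  m.+1%:R * \sum_(A : {set V} | #|A| == m.+1) F A ^+ 2.
Proof.
rewrite exchange_big /= (eq_bigr (fun S => \sum_(i | i \notin S) F (i |: S) ^+ 2)).
  rewrite sum_insert mulr_sumr; apply: eq_bigr => A /eqP cA.
  rewrite (eq_bigr (fun=> F A ^+ 2)) => [|x xA]; last by rewrite setD1K.
  by rewrite sumr_const cA mulr_natl.
move=> S _; rewrite [RHS]big_mkcond; apply: eq_bigr => i _.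
by rewrite /slice; case: (i \in S); rewrite ?expr0n.
Qed.

(** Twice the number of edges of the subgraph induced on [A]. *)
Definition internal_degree_sum A := (\sum_(b in A) #|[set a in A | edge G b a]|)%N.

(* A move a -> b inside (k-1)-sets lifts to a move of k-sets, except for the
   slices at i = a and i = b, where one end of the edge is truncated to 0. *)
Lemma sum_slice_energy m F :
  \sum_i token_energy m (slice F i) =
  m%:R * token_energy m.+1 F +
  2 * \sum_(A : {set V} | #|A| == m.+1) F A ^+ 2 * (internal_degree_sum A)%:R.
Proof.
have local S a b : a \in S -> b \notin S ->
    \sum_i (slice F i S - slice F i (move_token S a b)) ^+ 2 =
    \sum_(i | (i \notin S) && (i != b))
      (F (i |: S) - F (i |: move_token S a b)) ^+ 2 + 2 * F (b |: S) ^+ 2.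
  move=> aS bS; have ab : a != b by apply: contraNneq bS => <-.
  rewrite (bigD1 a) //= (bigD1 b) ?(eq_sym b) //= /slice aS (negPf bS).
  have -> : (a \in move_token S a b) = false by rewrite !inE eqxx (negPf ab).
  have -> : b \in move_token S a b by rewrite !inE eqxx.
  rewrite setU1_move_id // add0r subr0 sqrrN addrA [LHS]addrC; congr (_ + _).
    rewrite [RHS]big_mkcond [LHS]big_mkcond; apply: eq_bigr => i _ /=.
    rewrite !inE; case: (eqVneq i a) => [->|ia]; first by rewrite aS.
    case: (eqVneq i b) => [->|ib]; rewrite ?andbF //= andbT.
    by case: (i \in S); rewrite ?subrr ?expr0n.
  by rewrite mulr_natl mulr2n.
rewrite /token_energy exchange_big /=.
(* The boundary term of a move a -> b is charged to i = b, so that every term involves an inserted i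
   and [sum_insert] applies with A = S + i. *)
transitivity (\sum_(S : {set V} | #|S| == m) \sum_(i | i \notin S)
   (\sum_(a in S) \sum_(b | [&& b \notin S, b != i & edge G a b])
      (F (i |: S) - F (i |: move_token S a b)) ^+ 2 +
    \sum_(a in S | edge G i a) 2 * F (i |: S) ^+ 2)).
  apply: eq_bigr => S _; rewrite exchange_big big_split /=.
  transitivity (\sum_(a in S) \sum_(b | (b \notin S) && edge G a b)
    (\sum_(i | (i \notin S) && (i != b))
      (F (i |: S) - F (i |: move_token S a b)) ^+ 2 + 2 * F (b |: S) ^+ 2)).
    apply: eq_bigr => a aS; rewrite exchange_big /=; apply: eq_bigr => b /andP[bS _].
    exact: local.
  under [LHS]eq_bigr => a _ do rewrite big_split /=.
  rewrite big_split /=; congr (_ + _).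
    rewrite [RHS](exchange_big_dep (mem S)) //=; apply: eq_bigr => a aS.
    rewrite [RHS](exchange_big_dep (fun b => (b \notin S) && edge G a b)) /=.
      apply: eq_bigr => b /andP[bS eab]; apply: eq_bigl => i.
      by rewrite aS bS eab !andbT eq_sym.
    by move=> i b _ /and3P[-> _ ->].
  rewrite [RHS](exchange_big_dep (mem S)) /=; last by move=> i a _ /andP[].
  apply: eq_bigr => a aS; apply: eq_bigl => b.
  by rewrite aS edge_sym.
rewrite sum_insert !mulr_sumr -big_split; apply: eq_bigr => A /eqP cA.
rewrite big_split /=; congr (_ + _).
  (* A move a -> b of A is seen by the slices at the m elements i of A other than a; this is the
     factor [m%:R]. *)
  transitivity (\sum_(i in A) \sum_(a in A | a != i) \sum_(b | (b \notin A) && edge G a b)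
     (F A - F (move_token A a b)) ^+ 2).
    apply: eq_bigr => i iA; apply: eq_big => [a|a]; first by rewrite !inE andbC.
    rewrite !inE => /andP[ai aA]; apply: eq_big => [b|b _].
      rewrite !inE negb_and negbK.
      by case: (eqVneq b i) => [->|] //=; rewrite iA.
    by rewrite setU1_move ?(eq_sym i) // setD1K.
  rewrite (exchange_big_dep (mem A)) /=; last by move=> i a _ /andP[].
  rewrite mulr_sumr; apply: eq_bigr => a aA; rewrite sumr_const mulr_natl.
  congr (_ *+ _); have := cardsD1 a A; rewrite aA cA => -[->].
  apply: eq_card => i; rewrite -[LHS]/[&& i \in A, true & a != i].
  by rewrite !inE andbC eq_sym.
rewrite /internal_degree_sum natr_sum !mulr_sumr; apply: eq_bigr => b bA.
rewrite setD1K // sumr_const mulr_natr mulrnAr; congr (_ *+ _).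
apply: eq_card => a; rewrite -[LHS]/((a \in A :\ b) && edge G b a) !inE.
by case: (eqVneq a b) => [->|//]; rewrite edge_irr !andbF.
Qed.

(** Each of the m+1 vertices of A has at most m neighbours in A, not being its own neighbour, and at
    most [max_degree G]. *)
Lemma internal_degree_sum_le m A : #|A| = m.+1 ->
  (internal_degree_sum A <= m.+1 * minn m (max_degree G))%N.
Proof.
move=> cA; rewrite -cA -sum_nat_const; apply: leq_sum => b bA.
rewrite leq_min; apply/andP; split.
  have := cardsD1 b A; rewrite bA cA => -[->]; apply/subset_leq_card/subsetP => a.
  rewrite !inE => /andP[->]; rewrite andbT; apply: contraTneq => ->.
  by rewrite edge_irr.
apply: leq_trans (leq_bigmax b); apply/subset_leq_card/subsetP => a.
by rewrite !inE => /andP[].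
Qed.

(** The Poincare constant [c] is left abstract, so that it can be the connectivity of a token graph
    or, for m = 1, of [G] itself. The bound comes from applying [poin] to every slice of [F],
    summing, and dividing by twice the squared norm [N]. *)
Lemma token_eigenvalue_ge m F (c mu : R) : (0 < m)%N ->
  (forall g : {set V} -> R, \sum_(S : {set V} | #|S| == m) g S = 0 ->
     2 * c * \sum_(S : {set V} | #|S| == m) g S ^+ 2 <= token_energy m g) ->
  (forall S : {set V}, #|S| = m -> insertion_sum F S = 0) ->
  (forall A : {set V}, #|A| = m.+1 -> token_laplacian F A = mu * F A) ->
  (exists2 A : {set V}, #|A| = m.+1 & F A != 0) ->
  m.+1%:R * c <= m%:R * mu + m.+1%:R * (minn m (max_degree G))%:R.
Proof.
move=> m0 poin F0 FL [A0 cA0 FA0].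
set N := \sum_(A : {set V} | #|A| == m.+1) F A ^+ 2.
have N_gt0 : 0 < N.
  rewrite /N (bigD1 A0) ?cA0 //= ltr_pwDl ?exprn_even_gt0 //.
  by apply: sumr_ge0 => A _; apply: sqr_ge0.
have energyF : token_energy m.+1 F = 2 * (mu * N).
  rewrite -dirichlet_token dirichletE /N.
  rewrite -(sum_ksubset m.+1 (fun A : {set V} => F A ^+ 2)) [mu * _]mulr_sumr.
  congr (_ * _); apply: eq_bigr => X _; rewrite graph_laplacian_token FL ?(eqP (valP X)) //=.
  by rewrite mulrCA -expr2.
have : \sum_i 2 * c * \sum_(S : {set V} | #|S| == m) slice F i S ^+ 2 <=
       \sum_i token_energy m (slice F i).
  by apply: ler_sum => i _; apply/poin/sum_slice_eq0.
rewrite -mulr_sumr sum_slice_sqr sum_slice_energy energyF -/N.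
set E := \sum_(A | _) _; set M := minn _ _.
have E_le : E <= m.+1%:R * M%:R * N.
  rewrite /E /N mulr_sumr; apply: ler_sum => A /eqP cA.
  by rewrite mulrC ler_wpM2r ?sqr_ge0 // -natrM ler_nat internal_degree_sum_le.
move=> le1; rewrite -(ler_pM2r N_gt0); lra.
Qed.

Definition extend0 k (f : ksubset V k -> R) A : R :=
  if insub A is Some X then f X else 0.

Lemma extend0_val k (f : ksubset V k -> R) : extend0 f \o val =1 f.
Proof. by move=> X; rewrite /= /extend0 valK. Qed.

End TokenSums.

(** * Poincare inequalities for token graphs and the combined bound *)

Section TokenPoincare.
Variables (R : rcfType) (V : finType) (G : sgraph V).

Lemma token_poincare m (g : {set V} -> R) :
  \sum_(S : {set V} | #|S| == m) g S = 0 ->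
  2 * alg_connectivity R (token_graph m G) *
    \sum_(S : {set V} | #|S| == m) g S ^+ 2 <= token_energy G m g.
Proof.
rewrite -sum_ksubset -(sum_ksubset m (fun S : {set V} => g S ^+ 2)) -dirichlet_token.
exact: poincare.
Qed.

Lemma sum_singletons (phi : {set V} -> R) :
  \sum_(S : {set V} | #|S| == 1%N) phi S = \sum_x phi [set x].
Proof.
rewrite -[RHS](@big_imset _ _ _ _ _ _ predT); last by move=> x y _ _; apply: set1_inj.
apply: eq_bigl => S; apply/cards1P/imsetP => [[x ->]|[x _ ->]]; by exists x.
Qed.

(** For k = 2 the bound involves [G] rather than its 1-token graph; matching the energies through x
    -> {x} avoids transporting spectra along the isomorphism. *)
Lemma singleton_poincare (g : {set V} -> R) :
  \sum_(S : {set V} | #|S| == 1%N) g S = 0 ->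
  2 * alg_connectivity R G *
    \sum_(S : {set V} | #|S| == 1%N) g S ^+ 2 <= token_energy G 1 g.
Proof.
have -> : token_energy G 1 g = dirichlet G (g \o set1).
  rewrite /token_energy sum_singletons; apply: eq_bigr => x _; rewrite big_set1.
  apply: eq_big => [y|y _]; last by rewrite /move_token setDv setU0.
  by rewrite inE; case: eqVneq => // ->; rewrite edge_irr.
by rewrite !sum_singletons; apply: poincare.
Qed.

Lemma token_connectivity_ge m (c : R) : (0 < m <= #|V|)%N ->
  (forall g : {set V} -> R, \sum_(S : {set V} | #|S| == m) g S = 0 ->
     2 * c * \sum_(S : {set V} | #|S| == m) g S ^+ 2 <= token_energy G m g) ->
  ~~ eigenvalue (laplacian R (token_graph m G))
       (alg_connectivity R (token_graph m.+1 G)) ->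
  m.+1%:R * c <= m%:R * alg_connectivity R (token_graph m.+1 G) +
                 m.+1%:R * (minn m (max_degree G))%:R.
Proof.
case/andP=> m0 mV; set mu := alg_connectivity _ _ => poin muN.
(* Constants give the eigenvalue 0; they are nonzero functions because m <= [#|V|] makes the set of
   m-subsets nonempty. *)
have mu0 : mu != 0.
  apply: contraNneq muN => ->; apply/laplacian_eigenvalueP.
  exists (fun=> 1) => [X|].
    by rewrite mul0r; apply: big1 => Y _; rewrite subrr.
  have : (0 < #|[set A : {set V} | #|A| == m]|)%N.
    by rewrite card_draws bin_gt0.
  case/card_gt0P => A; rewrite inE => cA.
  by exists (Sub A cA); apply: oner_neq0.
have /laplacian_eigenvalueP[f fL [X0 fX0]] := alg_connectivity_eigenvalue mu0.
pose F := extend0 f.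
have FE X : F (val X) = f X := extend0_val f X.
have FL (A : {set V}) : #|A| = m.+1 -> token_laplacian G F A = mu * F A.
  move=> /eqP cA; rewrite -[A]/(val (Sub A cA : ksubset V m.+1)).
  rewrite -graph_laplacian_token FE -fL.
  by apply: eq_bigr => Y _; rewrite !extend0_val.
apply: (token_eigenvalue_ge m0 poin _ FL); last first.
  by exists (val X0); rewrite ?FE // (eqP (valP X0)).
(* If it did not vanish at some m-set, the insertion sum of F would be an eigenfunction for [mu] on
   the m-token graph. *)
move=> S /eqP cS; apply/eqP; apply: contraNT muN => FS.
apply/laplacian_eigenvalueP; exists (insertion_sum F \o val); last first.
  by exists (Sub S cS).
move=> X; rewrite graph_laplacian_token -insertion_sum_laplacian /= mulr_sumr.
apply: eq_bigr => x xX; apply: FL.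
by rewrite cardsU1 xX (eqP (valP X)).
Qed.

End TokenPoincare.

Theorem theorem3p6 (R : rcfType) (n k : nat) (G : sgraph 'I_n)
    (hk : (2 <= k <= n - 1)%N)
    (halpha : ~~ eigenvalue (laplacian R (token_graph (k - 1) G))
               (alg_connectivity R (token_graph k G))) :
  (if (2 < k)%N then
     k%:R / (k%:R - 1) * alg_connectivity R (token_graph (k - 1) G)
       - k%:R / (k%:R - 2) * Num.min (k%:R - 2) (max_degree G)%:R
   else 2 * alg_connectivity R G - 2)
  <= alg_connectivity R (token_graph k G).
Proof.
have [k2 kn] := andP hk.
case: k => [//|m] in hk k2 kn halpha *; rewrite subn1 /= in halpha *.
have mV : (0 < m <= #|'I_n|)%N.
  by rewrite -ltnS k2 card_ord (leq_trans (leqnSn m)) // (leq_trans kn) // leq_subr.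
have m_gt0 : (0 : R) < m%:R by rewrite ltr0n; case/andP: mV.
have natm1 : m.+1%:R = m%:R + 1 :> R by rewrite -natr1.
have [m2|m2] := ifPn; last first.
  have m1 : m = 1%N.
    by move: m2 k2; rewrite !ltnS; case: (m) => [|[]].
  (* With m = 1 the bound reads 2 a <= b + 2 d, where d = min(1, Delta) <= 1. *)
  subst m; have := token_connectivity_ge mV (@singleton_poincare R _ G) halpha.
  have : (minn 1 (max_degree G))%:R <= 1%:R :> R by rewrite ler_nat geq_minl.
  set a := alg_connectivity R G; set b := alg_connectivity R _; set d := _%:R.
  rewrite natm1; lra.
have := token_connectivity_ge mV (@token_poincare R _ G m) halpha.
set a := alg_connectivity R (token_graph m G); set b := alg_connectivity R _.
have m1_gt0 : (0 : R) < m%:R - 1 by rewrite subr_gt0 ltr1n.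
have -> : m.+1%:R - 1 = m%:R :> R by rewrite natm1 addrK.
have -> : m.+1%:R - 2 = m%:R - 1 :> R by rewrite natm1; lra.
set D := max_degree G; set p : R := _ / _ * Num.min _ _ => le1.
(* The ratio min(t, D) / t is nonincreasing in t > 0; compare t = m, from the bound just obtained,
   with t = m - 1, from the statement. *)
have le2 : m.+1%:R / m%:R * (minn m D)%:R <= p.
  rewrite /p -!mulrA ler_wpM2l ?ler0n // ![_^-1 * _]mulrC.
  rewrite ler_pdivlMr // mulrAC ler_pdivrMr //.
  have zD : (minn m D)%:R <= D%:R :> R by rewrite ler_nat geq_minr.
  have zm : (minn m D)%:R <= m%:R :> R by rewrite ler_nat geq_minl.
  have z0 : 0 <= (minn m D)%:R :> R by rewrite ler0n.
  have := ler_wpM2r (ltW m1_gt0) zm; have := ler_wpM2r (ltW m_gt0) zD.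
  by case: (lerP (m%:R - 1) (D%:R : R)) => _; lra.
apply: le_trans (_ : (m.+1%:R * a - m.+1%:R * (minn m D)%:R) / m%:R <= b).
  by rewrite mulrBl ![_ * _ / m%:R]mulrAC lerB.
by rewrite ler_pdivrMr //; lra.
Qed.
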